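(* Let $A$ be a local ring with maximal ideal $M$, let $f:A\to B$ be a ring homomorphism, and let $J$ be an ideal of $B$ such that $f^{-1}(Q)\neq M$ for each $Q\in\mathrm{Spec}(B)\setminus V(J)$. If $I$ is an ideal of $A$ whose radical is $M$, then the radical of the extended ideal $I(A\bowtie^f J)$ is $\{(m,f(m)+j)\mid m\in M,\ j\in J\}$.
   Context: All rings are commutative with unity; ''local'' means having exactly one maximal ideal. $A\bowtie^f J:=\{(a,f(a)+j)\mid a\in A,\ j\in J\}$ is a subring of $A\times B$, viewed as an extension of $A$ via $\iota:a\mapsto (a,f(a))$; $I(A\bowtie^f J)$ is the ideal of $A\bowtie^f J$ generated by $\iota(I)$. $V(J)$ is the set of prime ideals of $B$ containing $J$. *)

(* Defs.v *)
From HB Require Import structures.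
From mathcomp Require Import all_boot all_algebra.
From mathcomp Require Import boolp classical_sets.

Set Implicit Arguments.
Unset Strict Implicit.
Unset Printing Implicit Defensive.

Import GRing.Theory.
Local Open Scope classical_set_scope.
Local Open Scope ring_scope.

(* Rings are [comPzRingType]s, so the zero ring is allowed. The ideals of
   mathcomp's [ring_quotient] are not used because they are proper and
   boolean-valued; below, an ideal is an arbitrary set and may contain 1. *)

Section Ideals.
Variable R : comPzRingType.
Implicit Types I M P S : set R.

Definition is_ideal I : Prop :=
  [/\ I 0, (forall x y, I x -> I y -> I (x + y)) &
      (forall a x, I x -> I (a * x))].

Definition is_prime_ideal P : Prop :=
  [/\ is_ideal P, ~ P 1 & forall a b, P (a * b) -> P a \/ P b].

Definition is_maximal_ideal M : Prop :=
  [/\ is_ideal M, M <> setT &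
      forall I, is_ideal I -> M `<=` I -> I = M \/ I = setT].

Definition generated_ideal S : set R := smallest is_ideal S.

Definition radical I : set R :=
  [set x | exists2 n : nat, (0 < n)%N & I (x ^+ n)].

Definition Vset I : set (set R) := [set P | is_prime_ideal P /\ I `<=` P].

End Ideals.

Definition Spec (R : comPzRingType) : set (set R) :=
  [set P | is_prime_ideal P].

Definition is_local_ring (R : comPzRingType) (M : set R) : Prop :=
  is_maximal_ideal M /\ forall N : set R, is_maximal_ideal N -> N = M.

Arguments Spec R : clear implicits.

Section Amalgamation.
Variables (A B : comPzRingType) (f : {rmorphism A -> B}).
Variables (J : set B) (idJ : is_ideal J).

(* The proof [idJ] is an argument only so that the canonical ring structures
   below can be inferred. *)
Definition amalgamation_pred of is_ideal J : {pred A * B} :=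
  fun x => `[< exists a j, J j /\ x = (a, f a + j) >].

Local Notation pr := (amalgamation_pred idJ).

Lemma amalgamation_predP (x : A * B) :
  reflect (exists a j, J j /\ x = (a, f a + j)) (x \in pr).
Proof. exact: asboolP. Qed.

Lemma amalgamation_subring : subring_closed pr.
Proof.
case: (idJ) => J0 JD JM; split.
- apply/amalgamation_predP; exists 1, 0.
  by split=> //; rewrite rmorph1 addr0.
- move=> _ _ /amalgamation_predP[a [j [Jj ->]]]
    /amalgamation_predP[b [k [Jk ->]]].
  apply/amalgamation_predP; exists (a - b), (j - k); split.
    by apply: JD => //; rewrite -mulN1r; apply: JM.
  by congr pair; rewrite /= rmorphB addrACA opprD.
- move=> _ _ /amalgamation_predP[a [j [Jj ->]]]
    /amalgamation_predP[b [k [Jk ->]]].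
  apply/amalgamation_predP; exists (a * b), (f a * k + (f b + k) * j); split.
    by apply: JD; apply: JM.
  by congr pair; rewrite /= mulrDl mulrDr rmorphM addrA [j * _]mulrC.
Qed.

HB.instance Definition _ :=
  GRing.isSubringClosed.Build _ pr amalgamation_subring.

Record amalgamation : Type :=
  Amalgamation { amalgamation_val : A * B; _ : amalgamation_val \in pr }.

HB.instance Definition _ := [isSub for amalgamation_val].
HB.instance Definition _ := [Choice of amalgamation by <:].
HB.instance Definition _ :=
  GRing.SubChoice_isSubComPzRing.Build (A * B)%type pr amalgamation
    (subringClosedP _).

Lemma amalgamation_iota_subproof (a : A) : (a, f a) \in pr.
Proof.
by apply/amalgamation_predP; exists a, 0; case: (idJ) => ? _ _; rewrite addr0.
Qed.

Definition amalgamation_iota (a : A) : amalgamation :=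
  Amalgamation (amalgamation_iota_subproof a).

Lemma amalgamation_iota_is_zmod_morphism : zmod_morphism amalgamation_iota.
Proof.
by move=> a b; apply: val_inj; rewrite rmorphB /= rmorphB.
Qed.

Lemma amalgamation_iota_is_monoid_morphism :
  monoid_morphism amalgamation_iota.
Proof.
by split=> [|a b]; apply: val_inj; rewrite ?rmorph1 ?rmorphM /= ?rmorph1 ?rmorphM.
Qed.

HB.instance Definition _ := GRing.isZmodMorphism.Build A amalgamation
  amalgamation_iota amalgamation_iota_is_zmod_morphism.
HB.instance Definition _ := GRing.isMonoidMorphism.Build A amalgamation
  amalgamation_iota amalgamation_iota_is_monoid_morphism.

Definition extended_ideal (I : set A) : set amalgamation :=
  generated_ideal (amalgamation_iota @` I).

End Amalgamation.

Arguments amalgamation {A B} f {J} idJ.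
Arguments amalgamation_iota {A B} f {J} idJ a.
Arguments extended_ideal {A B} f {J} idJ I.

(* Main.v *)
Require Import Defs.
From HB Require Import structures.
From mathcomp Require Import all_boot all_algebra.
From mathcomp Require Import boolp classical_sets.

Set Implicit Arguments.
Unset Strict Implicit.
Unset Printing Implicit Defensive.

Import GRing.Theory.
Local Open Scope classical_set_scope.
Local Open Scope ring_scope.

(** The first projection is a ring morphism splitting iota, so it sends the
extended ideal E into [I] and the radical of E into the radical of [I], which
is [M].  This gives one inclusion.

For the other one, split (m, f m + j) as iota m + (0, j).  A power of iota m
lies in the image of [I], so the whole difficulty is to show that (0, j) has a
power in the extended ideal E.  A prime [Q] of [B] containing the image of [I]
contracts to a prime of [A] containing [I], hence to one containing the maximal
ideal [M], hence to [M] itself; the hypothesis on [f] then says that [Q]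
contains [J].  Hence [J] is contained in every prime over f(I)B, and by Krull's
theorem ([radical_of_primes]) a power of [j] lies in f(I)B.  This does not yet
concern E, because 0 x f(I)B need not lie in the amalgamation.  But multiplying
by one more element of [J] repairs this: (0, f i * b * j') is the product of
iota i and (0, b * j').  The ideal [slice] of those [b] for which 0 x bJ lies
in E is used in place of f(I)B: it contains f(I), and so a power of [j]. *)

(** * Primes and radicals *)

Section Primes.
Variable R : comPzRingType.
Implicit Types (I P Q : set R) (x : R).

Lemma ideal_mulr I x y : is_ideal I -> I x -> I (x * y).
Proof. by move=> [_ _ IM] Ix; rewrite mulrC; apply: IM. Qed.

Lemma prime_expr Q x n : is_prime_ideal Q -> Q (x ^+ n) -> Q x.
Proof.
move=> [_ Q1 QM]; elim: n => [|n IHn]; first by rewrite expr0.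
by rewrite exprS => /QM[].
Qed.

Lemma radical_sub_prime I Q :
  is_prime_ideal Q -> I `<=` Q -> radical I `<=` Q.
Proof. by move=> pQ IQ x [n _ /IQ]; apply: prime_expr. Qed.

Definition adjoin_element I (a : R) : set R :=
  [set x | exists q r, I q /\ x = q + r * a].

Lemma adjoin_element_ideal I a : is_ideal I -> is_ideal (adjoin_element I a).
Proof.
move=> [I0 ID IM]; split.
- by exists 0, 0; rewrite mul0r addr0.
- move=> _ _ [q [r [Iq ->]]] [q' [r' [Iq' ->]]].
  by exists (q + q'), (r + r'); split; [apply: ID | rewrite mulrDl addrACA].
- move=> c _ [q [r [Iq ->]]]; exists (c * q), (c * r).
  by split; [apply: IM | rewrite mulrDr mulrA].
Qed.

Lemma sub_adjoin_element I a : I `<=` adjoin_element I a.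
Proof. by move=> x Ix; exists x, 0; rewrite mul0r addr0. Qed.

Lemma adjoin_element_mem I a : is_ideal I -> adjoin_element I a a.
Proof. by move=> [I0 _ _]; exists 0, 1; rewrite mul1r add0r. Qed.

(** Exponent 0 is included, which makes an ideal that avoids the powers of [x]
proper. *)
Definition avoids_powers x I := forall n, ~ I (x ^+ n).

(** Zorn's lemma for sets is applied to the condition on [X] that [I `|` X] be
an ideal avoiding the powers of [x], rather than that [X] be one: this also
holds for the union of the empty chain. *)
Lemma maximal_avoiding_ideal I x : is_ideal I -> avoids_powers x I ->
  exists Q, [/\ is_ideal Q, I `<=` Q, avoids_powers x Q &
    forall Q', is_ideal Q' -> Q `<=` Q' -> avoids_powers x Q' -> Q' = Q].
Proof.
move=> idI Ix; have [I0 ID IM] := idI.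
pose good X := is_ideal (I `|` X) /\ avoids_powers x (I `|` X).
have [F goodF chF|X [[idX Xx] maxX]] := @Zorn_bigcup R good.
  split; last first.
    by move=> n [/Ix//|[X /goodF[_ Xx] Xn]]; apply: (Xx n); right.
  have in_chain X y : F X -> (I `|` X) y -> (I `|` \bigcup_(X in F) X) y.
    by move=> FX [Iy|Xy]; [left | right; exists X].
  (* Both lie in one I `|` X, unless they lie in I. *)
  have common y z : (I `|` \bigcup_(X in F) X) y ->
      (I `|` \bigcup_(X in F) X) z ->
      I y /\ I z \/ exists X, [/\ F X, (I `|` X) y & (I `|` X) z].
    move=> [Iy|[X FX Xy]] [Iz|[Y FY Yz]]; first by left.
    - by right; exists Y; split=> //; [left | right].
    - by right; exists X; split=> //; [right | left].
    - by right; have [XY|YX] := chF _ _ FX FY; [exists Y | exists X];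
        split=> //; right=> //; [apply: XY | apply: YX].
  split; first by left.
  - move=> y z Uy Uz; have [[Iy Iz]|[X [FX Xy Xz]]] := common _ _ Uy Uz.
      by left; apply: ID.
    by apply: (in_chain X) => //; have [[_ XD _] _] := goodF _ FX; apply: XD.
  - move=> a y [Iy|[X FX Xy]]; first by left; apply: IM.
    apply: (in_chain X) => //; have [[_ _ XM] _] := goodF _ FX.
    by apply: XM; right.
exists (I `|` X); split=> // Q' idQ' XQ' Q'x.
apply: contrapT => Q'X; apply: (maxX Q'); last first.
  by rewrite /good setUidr // => y Iy; apply: XQ'; left.
split=> [y Xy|Q'sub]; first by apply: XQ'; right.
by apply: Q'X; apply/seteqP; split=> // y /Q'sub; right.
Qed.

Lemma maximal_avoiding_prime Q x : is_ideal Q -> avoids_powers x Q ->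
    (forall Q', is_ideal Q' -> Q `<=` Q' -> avoids_powers x Q' -> Q' = Q) ->
  is_prime_ideal Q.
Proof.
move=> idQ Qx maxQ; have [_ QD QM] := idQ.
have power_in a : ~ Q a -> exists n, adjoin_element Q a (x ^+ n).
  move=> Qa; apply: contrapT => avoid; apply: Qa.
  rewrite -(maxQ (adjoin_element Q a)); first exact: adjoin_element_mem.
  - exact: adjoin_element_ideal.
  - exact: sub_adjoin_element.
  - by move=> n Qn; apply: avoid; exists n.
split=> // [Q1|a b Qab]; first by apply: (Qx 0); rewrite expr0.
have [Qa|nQa] := pselect (Q a); first by left.
have [Qb|nQb] := pselect (Q b); first by right.
have [n [q [r [Qq xn]]]] := power_in _ nQa.
have [m [q' [r' [Qq' xm]]]] := power_in _ nQb.
case: (Qx (n + m)%N); rewrite exprD xn mulrDl.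
apply: (QD); first exact: ideal_mulr.
by rewrite xm mulrDr; apply: QD; [apply: QM | rewrite mulrACA; apply: QM].
Qed.

(** Krull's theorem. *)
Lemma radical_of_primes I x : is_ideal I ->
  (forall Q, is_prime_ideal Q -> I `<=` Q -> Q x) -> radical I x.
Proof.
move=> idI Ix; apply: contrapT => radx.
have avoid : avoids_powers x I.
  by move=> n In; apply: radx; exists n.+1 => //; rewrite exprSr; apply: ideal_mulr.
have [Q [idQ IQ Qx maxQ]] := maximal_avoiding_ideal idI avoid.
by apply: (Qx 1); rewrite expr1; apply: Ix => //; apply: maximal_avoiding_prime Qx _.
Qed.

(** A prime contains a sum as soon as it contains both terms, so no binomial
expansion is needed. *)
Lemma radicalD I x y : is_ideal I ->
  radical I x -> radical I y -> radical I (x + y).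
Proof.
move=> idI radx rady; apply: radical_of_primes => // Q pQ IQ.
by have [[_ QD _] _ _] := pQ; apply: QD; apply: radical_sub_prime IQ _ _.
Qed.

Lemma generated_ideal_ideal (S : set R) : is_ideal (generated_ideal S).
Proof.
split.
- by move=> X [[]].
- move=> x y Sx Sy X SX; have [[_ XD _] _] := SX.
  by apply: XD; [apply: Sx | apply: Sy].
- by move=> a x Sx X SX; have [[_ _ XM] _] := SX; apply: XM; apply: Sx.
Qed.

End Primes.

Lemma preimage_prime_ideal (A B : comPzRingType) (f : {rmorphism A -> B})
  (Q : set B) : is_prime_ideal Q -> is_prime_ideal (f @^-1` Q).
Proof.
move=> [[Q0 QD QM] Q1 Qprime]; split; first split.
- by rewrite /preimage /= rmorph0.
- by move=> x y; rewrite /preimage /= rmorphD; apply: QD.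
- by move=> a x; rewrite /preimage /= rmorphM; apply: QM.
- by rewrite /preimage /= rmorph1.
- by move=> a b; rewrite /preimage /= rmorphM; apply: Qprime.
Qed.

(** * The extended ideal of the amalgamation *)

Section Extension.
Variables (A B : comPzRingType) (f : {rmorphism A -> B}).
Variables (J : set B) (idJ : is_ideal J) (I : set A).
Implicit Types (x y : amalgamation f idJ).

Local Notation E := (extended_ideal f idJ I).
Local Notation iota := (amalgamation_iota f idJ).

Lemma amalgamation_valP x : exists a j, J j /\ val x = (a, f a + j).
Proof. exact/(amalgamation_predP f idJ)/valP. Qed.

Lemma amalgamation_inr j : J j -> exists x, val x = (0, j).
Proof.
move=> Jj; have pj : (0, j) \in amalgamation_pred f idJ.
  by apply/amalgamation_predP; exists 0, j; rewrite rmorph0 add0r.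
by exists (Amalgamation pj).
Qed.

Lemma extended_ideal_ideal : is_ideal E.
Proof. exact: generated_ideal_ideal. Qed.

Lemma extended_ideal_iota a : I a -> E (iota a).
Proof. by move=> Ia X [_]; apply; exists a. Qed.

(** The first projection sends the extended ideal into [I], since it is a ring
morphism splitting iota. *)
Lemma extended_ideal_fst x : is_ideal I -> E x -> I (val x).1.
Proof.
move=> [I0 ID IM] Ex; apply: (Ex [set y | I (val y).1]).
split=> [|_ [a Ia <-]] //; split=> //.
- by move=> y z; apply: ID.
- by move=> y z; apply: IM.
Qed.

(** Those [b] with (0, b) in [E] need not form an ideal of [B], since only
multiplication by elements of f(A) + J is available.  Asking instead that
0 x bJ lie in [E] gives an ideal, because [J] absorbs the multiplier. *)
Definition slice : set B :=
  [set b | forall j, J j -> exists2 x, E x & val x = (0, b * j)].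

Lemma slice_ideal : is_ideal slice.
Proof.
have [E0 ED _] := extended_ideal_ideal; have [_ _ JM] := idJ; split.
- by move=> j _; exists 0; rewrite ?mul0r.
- move=> b c Kb Kc j Jj; have [x Ex xE] := Kb j Jj; have [y Ey yE] := Kc j Jj.
  exists (x + y); first exact: ED.
  by rewrite rmorphD /= xE yE mulrDl; congr pair; rewrite /= addr0.
- move=> c b Kb j Jj; have [x Ex xE] := Kb (c * j) (JM _ _ Jj).
  by exists x => //; rewrite xE mulrA [b * c]mulrC.
Qed.

Lemma slice_image a : I a -> slice (f a).
Proof.
move=> Ia j Jj; have [x xE] := amalgamation_inr Jj.
exists (iota a * x); last by rewrite rmorphM /= xE; congr pair; rewrite /= mulr0.
by apply: ideal_mulr extended_ideal_ideal _; apply: extended_ideal_iota.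
Qed.

Lemma radical_extended_iota a : radical I a -> radical E (iota a).
Proof.
by move=> [n n0 In]; exists n => //; rewrite -rmorphXn; apply: extended_ideal_iota.
Qed.

(** The exponent grows by one: the slice only speaks of products with an
element of [J], and that element is taken to be [j] itself. *)
Lemma radical_extended_inr j x : J j -> radical slice j ->
  val x = (0, j) -> radical E x.
Proof.
move=> Jj [n n0 jn] xE; exists n.+1 => //.
have [y Ey yE] := jn j Jj; suff -> : x ^+ n.+1 = y by [].
have val_exp k : (val x ^+ k.+1) = (0, j ^+ k.+1).
  elim: k => [|k IHk]; first by rewrite !expr1.
  by rewrite exprS IHk xE [in RHS]exprS; congr pair; rewrite /= mul0r.
by apply: val_inj; rewrite rmorphXn val_exp yE exprSr.
Qed.

End Extension.

Theorem corollary3p2 (A B : comPzRingType) (M : set A)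
  (localA : is_local_ring M)
  (f : {rmorphism A -> B}) (J : set B) (idJ : is_ideal J)
  (hJ : forall Q : set B, (Spec B `\` Vset J) Q -> f @^-1` Q <> M)
  (I : set A) (idI : is_ideal I) (radI : radical I = M) :
  radical (extended_ideal f idJ I) =
  [set x : amalgamation f idJ |
     exists m j, [/\ M m, J j & val x = (m, f m + j)]].
Proof.
have [[_ _ M_max] _] := localA.
have J_radical j : J j -> radical (slice f idJ I) j.
  move=> Jj; apply: radical_of_primes => [|Q pQ KQ]; first exact: slice_ideal.
  have pfQ := preimage_prime_ideal f pQ; have [idfQ fQ1 _] := pfQ.
  have MfQ : M `<=` f @^-1` Q.
    by rewrite -radI; apply: radical_sub_prime => // a Ia; apply/KQ/slice_image.
  have fQM : f @^-1` Q = M.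
    by have [//|fQT] := M_max _ idfQ MfQ; case: fQ1; rewrite fQT.
  apply: contrapT => nQj; apply: (hJ Q _ fQM); split=> // -[_ JQ].
  exact/nQj/JQ.
apply/seteqP; split=> x.
  move=> [n n0 Exn]; have [a [j [Jj xE]]] := amalgamation_valP x.
  exists a, j; split=> //; rewrite -radI; exists n => //.
  have := extended_ideal_fst idI Exn.
  have -> : (val (x ^+ n)).1 = (val x).1 ^+ n.
    by rewrite rmorphXn -[LHS]/(fst (val x ^+ n)) rmorphXn.
  by rewrite xE.
move=> [m [j [Mm Jj xE]]]; have [y yE] := amalgamation_inr f idJ Jj.
have -> : x = amalgamation_iota f idJ m + y.
  by apply: val_inj; rewrite rmorphD xE /= yE; congr pair; rewrite /= addr0.
apply: radicalD; first exact: extended_ideal_ideal.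
  by apply: radical_extended_iota; rewrite radI.
exact: radical_extended_inr (J_radical _ Jj) yE.
Qed.
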